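(* Fix integers $0 \leq t < n$. Let $G$ be a graph and let $G_1, G_2, \dots, G_n$ be subgraphs of $G$ such that every edge of $G$ lies in at least $n-t$ of the $G_i$. Then \[ \chi(G_1)\chi(G_2)\cdots\chi(G_n) \geq \chi(G)^{n/(t+1)}. \] Furthermore, for any such $t<n$ there are examples with $\chi(G)$ arbitrarily large for which this bound is tight: for every $N$ there exist a graph $G$ with $\chi(G) \geq N$ and subgraphs $G_1,\dots,G_n$ of $G$ such that every edge of $G$ lies in at least $n-t$ of the $G_i$ and $\chi(G_1)\chi(G_2)\cdots\chi(G_n) = \chi(G)^{n/(t+1)}$.
   Context: Graphs are finite and simple; $\chi$ denotes the chromatic number. The subgraphs $G_i$ are all taken on the full vertex set $V(G)$ (spanning subgraphs), so that $G_i$ is determined by its edge set $E(G_i)\subseteq E(G)$. *)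

(* Defs.v *)
From mathcomp Require Import all_boot.

Set Implicit Arguments.
Unset Strict Implicit.
Unset Printing Implicit Defensive.

Record sgraph (T : finType) := SGraph {
  adj :> rel T;
  adj_sym : symmetric adj;
  adj_irrefl : irreflexive adj
}.

(* Both graphs live on the full vertex set [T], so only edges are compared. *)
Definition spanning_subgraph (T : finType) (H G : sgraph T) : Prop :=
  forall x y : T, H x y -> G x y.

Definition colorable (T : finType) (G : sgraph T) (k : nat) : bool :=
  [exists f : {ffun T -> 'I_k},
     [forall x : T, forall y : T, G x y ==> (f x != f y)]].

Lemma colorable_card (T : finType) (G : sgraph T) : exists k, colorable G k.
Proof.
exists #|T|; apply/existsP; exists [ffun x => enum_rank x].
apply/forallP => x; apply/forallP => y; apply/implyP => Gxy.
rewrite !ffunE (inj_eq enum_rank_inj); apply: contraTneq Gxy => ->.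
by rewrite adj_irrefl.
Qed.

(* The chromatic number is 0 exactly when the vertex set is empty. *)
Definition chi (T : finType) (G : sgraph T) : nat := ex_minn (colorable_card G).

(* Main.v *)
(** The hypothesis says that every edge is missed by at most [t] of the [G_i],
    so any [t + 1] of them cover [G], and the product of proper colourings of
    them is a proper colouring of [G].  Multiplying the resulting inequalities
    over the [n] cyclic windows of [t + 1] consecutive indices gives
    [chi(G)^n <= (chi(G_1) ... chi(G_n))^(t+1)].
    Tightness comes from Reed-Solomon codes: let [G] be the complete graph on
    the polynomials of degree at most [t] over ['F_p], with [p >= n], and join
    two polynomials in [G_i] when they differ at the point [i].  Two distinct
    polynomials agree at no more than [t] points, and [chi(G_i) <= p]. *)

Require Import Defs.
From mathcomp Require Import all_boot all_order all_algebra.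
From mathcomp Require Import reals exp.

Set Implicit Arguments.
Unset Strict Implicit.
Unset Printing Implicit Defensive.

Import Order.TTheory GRing.Theory Num.Theory.
Local Open Scope ring_scope.

Lemma colorableP (T : finType) (G : sgraph T) (k : nat) :
  reflect (exists f : T -> 'I_k, forall x y, G x y -> f x != f y)
          (colorable G k).
Proof.
apply: (iffP existsP) => [[f /forallP Hf]|[f Hf]].
  by exists f => x y Gxy; move/forallP/(_ y)/implyP: (Hf x); apply.
exists [ffun x => f x]; apply/forallP=> x; apply/forallP=> y; apply/implyP=> Gxy.
by rewrite !ffunE Hf.
Qed.

Lemma colorable_fintype (T C : finType) (G : sgraph T) (f : T -> C) :
  (forall x y, G x y -> f x != f y) -> colorable G #|C|.
Proof.
move=> Hf; apply/colorableP; exists (fun x => enum_rank (f x)) => x y Gxy.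
by rewrite (inj_eq enum_rank_inj) Hf.
Qed.

Lemma colorable_chi (T : finType) (G : sgraph T) : colorable G (chi G).
Proof. by rewrite /chi; case: ex_minnP. Qed.

Lemma chi_le (T : finType) (G : sgraph T) (k : nat) :
  colorable G k -> (chi G <= k)%N.
Proof. by rewrite /chi; case: ex_minnP => m _; apply. Qed.

(** Each vertex receives the tuple of its colours in optimal colourings of the [H i]; an edge of
    [H i] is already separated by coordinate [i]. *)
Lemma product_coloring (T : finType) (I : eqType) (H : I -> sgraph T)
    (s : seq I) :
  exists (C : finType) (f : T -> C), #|C| = (\prod_(i <- s) chi (H i))%N /\
    forall i, i \in s -> forall x y, H i x y -> f x != f y.
Proof.
elim: s => [|i s [C [f [cardC Hf]]]].
  by exists unit, (fun=> tt); rewrite big_nil card_unit.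
have /colorableP[g Hg] := colorable_chi (H i).
exists ('I_(chi (H i)) * C)%type, (fun x => (g x, f x)); split.
  by rewrite card_prod card_ord cardC big_cons.
move=> j; rewrite inE => /predU1P[->|js] x y Hxy; rewrite xpair_eqE negb_and.
  by rewrite Hg.
by rewrite (Hf j) ?orbT.
Qed.

Lemma chi_cover_le (T : finType) (I : eqType) (G : sgraph T)
    (H : I -> sgraph T) (s : seq I) :
  (forall x y, G x y -> exists2 i, i \in s & H i x y) ->
  (chi G <= \prod_(i <- s) chi (H i))%N.
Proof.
move=> cov; have [C [f [<- Hf]]] := product_coloring H s.
apply/chi_le/(colorable_fintype (f := f)) => x y /cov[i si Hxy].
exact: Hf si _ _ Hxy.
Qed.

(** For a fixed offset [l], translation by [l] permutes the cyclic group ['I_n.+1], so each of the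
    [t] offsets contributes the full product. *)
Lemma prod_cyclic_windows (n t : nat) (c : 'I_n.+1 -> nat) :
  (\prod_(j < n.+1) \prod_(l < t) c (j + inZp l)%R
   = (\prod_(i < n.+1) c i) ^ t)%N.
Proof.
rewrite exchange_big /= -[t in RHS]card_ord -prod_nat_const.
by apply: eq_bigr => l _; rewrite [RHS](reindex_inj (addIr (inZp l))).
Qed.

Lemma chi_expn_le (n t : nat) (tn : (t < n)%N) (T : finType) (G : sgraph T)
    (H : 'I_n -> sgraph T) :
  (forall x y, G x y -> (n - t <= #|[pred i : 'I_n | H i x y]|)%N) ->
  (chi G ^ n <= (\prod_(i < n) chi (H i)) ^ t.+1)%N.
Proof.
case: n tn H => // n tn H HG.
rewrite -prod_cyclic_windows -{1}[n.+1]card_ord -prod_nat_const.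
apply: leq_prod => j _.
rewrite -(big_map (fun l : 'I_t.+1 => j + inZp l) xpredT (fun i => chi (H i))).
apply: chi_cover_le => x y /HG.
set s := map _ _; set A := [pred i | _] => leA.
(* The offsets are below [t.+1 <= n.+1], so they stay distinct modulo [n.+1]. *)
have uniq_s : uniq s.
  rewrite map_inj_uniq ?index_enum_uniq // => k l /addrI /(congr1 val) /=.
  by rewrite !modn_small ?(leq_trans (ltn_ord _) tn) // => /val_inj.
have size_s : size s = t.+1 by rewrite size_map [index_enum _]unlock -enumT size_enum_ord.
(* A window avoiding [A] would lie in its complement, forcing [(n.+1 - t) + t.+1 <= n.+1]. *)
have [/hasP //|/hasPn sNA] := boolP (has A s); exfalso.
have : (#|s| <= #|[predC A]|)%N by apply/subset_leq_card/subsetP => i /sNA.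
move/card_uniqP: uniq_s => ->; rewrite size_s => lts.
have := leq_add leA lts; rewrite cardC card_ord addnS subnK ?ltnn //.
exact: ltnW.
Qed.

Lemma separated_sym (T : Type) (C : eqType) (f : T -> C) :
  symmetric (fun x y => f x != f y).
Proof. by move=> x y; rewrite eq_sym. Qed.

Lemma separated_irrefl (T : Type) (C : eqType) (f : T -> C) :
  irreflexive (fun x y => f x != f y).
Proof. by move=> x; rewrite eqxx. Qed.

(** The complete multipartite graph on the fibres of [f]; the identity gives the complete graph. *)
Definition separated (T : finType) (C : eqType) (f : T -> C) : sgraph T :=
  SGraph (separated_sym f) (separated_irrefl f).

Lemma chi_separated_le (T C : finType) (f : T -> C) :
  (chi (separated f) <= #|C|)%N.
Proof. exact/chi_le/(colorable_fintype (f := f)). Qed.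

Lemma chi_complete (T : finType) : chi (separated (@id T)) = #|T|.
Proof.
apply/eqP; rewrite eqn_leq chi_separated_le /=.
have /colorableP[f Hf] := colorable_chi (separated (@id T)).
rewrite -[leqRHS]card_ord; apply: (leq_card f) => x y /eqP.
by apply: contraTeq => /Hf.
Qed.

(** Agreement points are distinct roots of the nonzero difference, whose [t.+1] coefficients bound
    its degree by [t]. *)
Lemma agreement_card (F : fieldType) (n t : nat) (a : 'I_n -> F)
    (x y : 'rV[F]_t.+1) : injective a -> x != y ->
  (#|[pred i : 'I_n | (rVpoly x).[a i] == (rVpoly y).[a i]]| <= t)%N.
Proof.
move=> inj_a xy; set A := [pred i | _].
have nz : rVpoly x - rVpoly y != 0.
  by rewrite subr_eq0; apply: contraNneq xy => /(can_inj rVpolyK) ->.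
have := max_poly_roots (rs := [seq a i | i in A]) nz.
rewrite size_map -cardE map_inj_uniq ?enum_uniq // => ltA.
rewrite -ltnS; apply: leq_trans (ltA _ isT) _.
  apply/allP => _ /mapP[i + ->]; rewrite mem_enum => /eqP Ai.
  by rewrite rootE hornerD hornerN Ai subrr.
by rewrite -linearB size_poly.
Qed.

(** Both sides are nonnegative, so raising to the power [t.+1] clears the denominator of the
    exponent. *)
Lemma powR_natdiv_le (R : realType) (a b n t : nat) : (a ^ n <= b ^ t.+1)%N ->
  (a%:R : R) `^ (n%:R / t.+1%:R) <= b%:R.
Proof.
move=> le_ab; rewrite -(@ler_pXn2r _ t.+1) ?nnegrE ?powR_ge0 ?ler0n //.
rewrite -powR_mulrn ?powR_ge0 // -powRrM mulfVK ?pnatr_eq0 //.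
by rewrite powR_mulrn ?ler0n // -!natrX ler_nat.
Qed.

Theorem theorem2 (R : realType) (n t : nat) (tn : (t < n)%N) :
  (forall (T : finType) (G : sgraph T) (H : 'I_n -> sgraph T),
     (forall i, spanning_subgraph (H i) G) ->
     (forall x y : T, G x y -> (n - t <= #|[pred i : 'I_n | H i x y]|)%N) ->
     ((chi G)%:R : R) `^ (n%:R / t.+1%:R) <= \prod_(i < n) (chi (H i))%:R)
  /\
  (forall N : nat,
     exists (T : finType) (G : sgraph T) (H : 'I_n -> sgraph T),
       [/\ (N <= chi G)%N,
           forall i, spanning_subgraph (H i) G,
           forall x y : T, G x y ->
             (n - t <= #|[pred i : 'I_n | H i x y]|)%N
         & \prod_(i < n) (chi (H i))%:R
             = ((chi G)%:R : R) `^ (n%:R / t.+1%:R)]).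
Proof.
have bound (T : finType) (G : sgraph T) (H : 'I_n -> sgraph T) :
     (forall x y : T, G x y -> (n - t <= #|[pred i : 'I_n | H i x y]|)%N) ->
     ((chi G)%:R : R) `^ (n%:R / t.+1%:R) <= \prod_(i < n) (chi (H i))%:R.
  by move=> HG; rewrite -natr_prod; apply/powR_natdiv_le/chi_expn_le.
split=> [T G H _|N]; first exact: bound.
(* [p > n] keeps the [n] evaluation points distinct in ['F_p]; [p > N] makes [chi G = p ^ t.+1]
   large. *)
have [p ltp pr_p] := prime_above (maxn n N).
move: ltp; rewrite gtn_max => /andP[ltnp ltNp].
pose a (i : 'I_n) : 'F_p := i%:R.
have inj_a : injective a.
  move=> i j /(congr1 val); rewrite /= !val_Fp_nat //.
  by rewrite !modn_small ?(ltn_trans (ltn_ord _)) // => /val_inj.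
pose G := separated (@id 'rV['F_p]_t.+1).
pose H i := separated (fun x : 'rV['F_p]_t.+1 => (rVpoly x).[a i]).
have chiG : chi G = (p ^ t.+1)%N by rewrite chi_complete card_mx card_Fp // mul1n.
have cov x y : G x y -> (n - t <= #|[pred i : 'I_n | H i x y]|)%N.
  move=> xy; set A := [pred i | _].
  rewrite leq_subLR -[n in leqLHS]card_ord -(cardC A) addnC leq_add2r.
  apply: leq_trans (agreement_card inj_a xy).
  by apply/subset_leq_card/subsetP => i; rewrite !inE negbK.
exists _, G, H; split => //.
- by rewrite chiG expnS (leq_trans (ltnW ltNp)) // leq_pmulr ?expn_gt0 ?prime_gt0.
- by move=> i x y; apply: contraNneq => /= ->.
(* One inequality is [bound]; for the other, the right side equals [p ^ n] and each factor is at
   most [p]. *)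
apply/eqP; rewrite eq_le bound // andbT chiG natrX.
rewrite -powR_mulrn ?ler0n // -powRrM mulrC mulfVK ?pnatr_eq0 //.
rewrite powR_mulrn ?ler0n // -natr_prod -natrX ler_nat.
rewrite -[n in (_ ^ n)%N]card_ord -prod_nat_const.
by apply: leq_prod => i _; rewrite -[leqRHS]card_Fp // chi_separated_le.
Qed.
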